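(* Let $\mathbb{F}$ be a field of characteristic zero, $n\ge 1$, $m=2n-1$, and let $\mathfrak{sl}(2)\ltimes \mathfrak{a}_m$ be the Lie algebra in which $\mathfrak{a}_m$ is an abelian ideal isomorphic to $V(m)$ as an $\mathfrak{sl}(2)$-module. Let $V_1=E(a,b)$ with $a+b=m$ and $a,b\neq 0$, with socle decomposition $V_1=V(a)\oplus V(b)$. Let $V_2=V(c)\oplus V(d)$ be the socle decomposition of a uniserial $(\mathfrak{sl}(2)\ltimes\mathfrak{a}_m)$-module of composition length $2$, and put $$S_1(V_1,V_2)=\big(V(a)\otimes V(d)\;\oplus\; V(b)\otimes V(c)\big)^{\mathfrak{a}_m}\subseteq V_1\otimes V_2 .$$ Then: (i) If $V_2\simeq E(c,d)$ with $c+d=m$ and $0<a\le c<m$, then, as $\mathfrak{sl}(2)$-modules, $S_1(V_1,V_2)\simeq V(d-a)$ if $d-a=b-c\ge 0$, and $S_1(V_1,V_2)=0$ otherwise. (ii) If $V_2\simeq Z(c,1)\simeq E(c,c+m)$, then, as $\mathfrak{sl}(2)$-modules, $S_1(V_1,V_2)\simeq V(b)$ if $c=0$, and $S_1(V_1,V_2)=0$ if $c\neq 0$. (iii) If $V_2\simeq Z(d,1)^*\simeq E(d+m,d)$, then $S_1(V_1,V_2)=0$.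
   Context: All Lie algebras and modules are finite dimensional over $\mathbb{F}$ (characteristic zero). $V(k)$ denotes the irreducible $\mathfrak{sl}(2)$-module of highest weight $k$ ($\dim V(k)=k+1$). For a module $U$ over a Lie algebra $\mathfrak{g}$, $\mathrm{soc}(U)$ is the sum of all irreducible submodules; the socle series is $0=\mathrm{soc}^0(U)\subset \mathrm{soc}^1(U)\subset\cdots$ with $\mathrm{soc}^{i}(U)/\mathrm{soc}^{i-1}(U)=\mathrm{soc}(U/\mathrm{soc}^{i-1}(U))$. $U$ is uniserial if it has a unique composition series, i.e. all socle factors are irreducible. For a uniserial $(\mathfrak{sl}(2)\ltimes\mathfrak{a}_m)$-module $U$ of composition length $\ell+1$, a socle decomposition is a decomposition $U=V(a_0)\oplus\cdots\oplus V(a_\ell)$ into irreducible $\mathfrak{sl}(2)$-submodules with $\mathrm{soc}^{i+1}(U)=V(a_0)\oplus\cdots\oplus V(a_i)$ for all $i$ (the order of summands matters). The tensor product carries the action $x(v\otimes w)=xv\otimes w+v\otimes xw$, and $(\cdot)^{\mathfrak{a}_m}$ denotes the subspace annihilated by $\mathfrak{a}_m$. For nonnegative integers $a,b$ with $a+b\equiv m \pmod 2$ and $|a-b|\le m\le a+b$, there is, up to scalar, a unique nonzero $\mathfrak{sl}(2)$-module map $\mathfrak{a}_m\otimes V(b)\to V(a)$; $E(a,b)$ is the $\mathfrak{sl}(2)$-module $V(a)\oplus V(b)$ on which $\mathfrak{a}_m$ acts by killing $V(a)$ and mapping $V(b)$ into $V(a)$ via this map. It is uniserial with socle $V(a)$.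 For integers $\alpha,\ell\ge 0$, $Z(\alpha,\ell)$ is the $\mathfrak{sl}(2)$-module $V(\alpha)\oplus V(\alpha+m)\oplus\cdots\oplus V(\alpha+\ell m)$ where $\mathfrak{a}_m$ kills $V(\alpha)$ and maps each $V(\alpha+im)$ into $V(\alpha+(i-1)m)$ via the nonzero equivariant map above; $Z(\alpha,\ell)^*$ is its dual. In particular $Z(c,1)=E(c,c+m)$ and $Z(d,1)^*\simeq E(d+m,d)$. *)

(* Defs.v *)
From HB Require Import structures.
From mathcomp Require Import all_boot all_order all_algebra.
Set Implicit Arguments. Unset Strict Implicit. Unset Printing Implicit Defensive.
Import Order.TTheory GRing.Theory Num.Theory.
Local Open Scope ring_scope.

(* Conventions: a module of dimension p is given by p x p matrices acting on
   column vectors from the left.  The tensor product V (x) W of modules of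
   dimensions p, q is identified with 'M_(p,q) (v (x) w <-> v *m w^T); an
   element x acting by A on V and B on W acts by M |-> A M + M B^T. *)

Inductive sl2gen := gE | gF | gH.

(* V(k): basis v_0..v_k, h v_i = (k-2i) v_i, f v_i = v_{i+1}, e v_i = i(k-i+1) v_{i-1}.
   Entry (r, j) = coefficient of v_r in the image of v_j. *)
Definition sl2mat (K : fieldType) (g : sl2gen) (k : nat) : 'M[K]_(k.+1) :=
  \matrix_(r < k.+1, j < k.+1)
    match g with
    | gE => if (r : nat).+1 == (j : nat) then (j * (k - j).+1)%:R else 0
    | gF => if (r : nat) == (j : nat).+1 then 1 else 0
    | gH => if (r : nat) == (j : nat) then ((k%:Z - 2 * j%:Z)%:~R) else 0
    end.

(* phi i : matrix of v |-> phi(x_i (x) v), V(b) -> V(a), where x_0..x_m is the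
   basis of a_m ~ V(m) corresponding to the standard basis of V(m).
   cg_map m a b phi : phi is a nonzero sl(2)-module map a_m (x) V(b) -> V(a). *)
Definition cg_map (K : fieldType) (m a b : nat) (phi : 'I_m.+1 -> 'M[K]_(a.+1, b.+1)) : Prop :=
  (exists i, phi i != 0) /\
  forall (g : sl2gen) (i : 'I_m.+1),
    sl2mat K g a *m phi i = \sum_(j < m.+1) sl2mat K g m j i *: phi j + phi i *m sl2mat K g b.

Definition Esl2 (K : fieldType) (a b : nat) (g : sl2gen) : 'M[K]_(a.+1 + b.+1) :=
  block_mx (sl2mat K g a) 0 0 (sl2mat K g b).
Definition Ex (K : fieldType) (m a b : nat) (phi : 'I_m.+1 -> 'M[K]_(a.+1, b.+1))
  (i : 'I_m.+1) : 'M[K]_(a.+1 + b.+1) :=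
  block_mx 0 (phi i) 0 0.

Definition tensor_act (K : fieldType) (p q : nat) (A : 'M[K]_p) (B : 'M[K]_q)
  (M : 'M[K]_(p, q)) : 'M[K]_(p, q) := A *m M + M *m B^T.

(* S_1(V_1, V_2) = (V(a)(x)V(d) (+) V(b)(x)V(c))^{a_m} inside V_1 (x) V_2,
   V_1 = E(a,b) (via phi1), V_2 = V(c) (+) V(d) (via phi2). *)
Definition S1 (K : fieldType) (m a b c d : nat)
  (phi1 : 'I_m.+1 -> 'M[K]_(a.+1, b.+1)) (phi2 : 'I_m.+1 -> 'M[K]_(c.+1, d.+1))
  (M : 'M[K]_(a.+1 + b.+1, c.+1 + d.+1)) : Prop :=
  ulsubmx M = 0 /\ drsubmx M = 0 /\
  forall i : 'I_m.+1, tensor_act (Ex phi1 i) (Ex phi2 i) M = 0.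

Definition sl2_tensor (K : fieldType) (a b c d : nat) (g : sl2gen)
  (M : 'M[K]_(a.+1 + b.+1, c.+1 + d.+1)) :=
  tensor_act (Esl2 K a b g) (Esl2 K c d g) M.

Definition iso_Vk (K : fieldType) (p q : nat) (act : sl2gen -> 'M[K]_(p, q) -> 'M[K]_(p, q))
  (S : 'M[K]_(p, q) -> Prop) (k : nat) : Prop :=
  exists B : 'I_k.+1 -> 'M[K]_(p, q),
    (forall c : 'I_k.+1 -> K, \sum_(j < k.+1) c j *: B j = 0 -> forall j, c j = 0) /\
    (forall M, S M <-> exists c : 'I_k.+1 -> K, M = \sum_(j < k.+1) c j *: B j) /\
    (forall (g : sl2gen) (j : 'I_k.+1),
        act g (B j) = \sum_(l < k.+1) sl2mat K g k l j *: B l).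

Definition is_zero_sub (K : fieldType) (p q : nat) (S : 'M[K]_(p, q) -> Prop) : Prop :=
  forall M, S M -> M = 0.

(* Main.v *)
(* Writing an element of V(a) (x) V(d) (+) V(b) (x) V(c) as a pair of matrices (P, Q),
   invariance under a_m reads phi1_i Q + P phi2_i^T = 0 for all i.  The maps phi are
   explicit: invariance under h confines phi_i to one antidiagonal, and there
   - for a + b = m and for b = a + m, invariance under f is Pascal's recursion, so the
     entries are signed binomials;
   - for a = b + m (Cartan product), invariance under e shows that the entries with
     i = 0 and i = m do not vanish.
   Each entry of the invariance equation then involves one entry of P and one of Q.
   When c + d = m these two-term equations are solved by the combinations of the
   matrices (-1)^r C(d - u, r) supported on r + u = a + j, which form a copy of
   V(d - a); case (ii) with c = 0 is the instance d = m.  In the other cases the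
   equations force P = Q = 0. *)
Require Import Defs.
From mathcomp Require Import all_boot all_order all_algebra.
From mathcomp Require Import ring zify.
Import Order.TTheory GRing.Theory Num.Theory.
Local Open Scope ring_scope.
Set Implicit Arguments.
Unset Strict Implicit.

(** * Matrix entries at natural-number indices and the action of sl(2) on them *)

(** Extension by zero keeps shifted indices such as [r.+1] meaningful at the border, where the
    vector after the last basis vector counts as zero. *)
Definition ent {K : fieldType} {p q : nat} (M : 'M[K]_(p.+1, q.+1)) (r s : nat) : K :=
  if (r <= p)%N && (s <= q)%N then M (inord r) (inord s) else 0.

Section Entries.
Variable K : fieldType.
Implicit Types p q r s : nat.

Lemma ent_ord p q (M : 'M[K]_(p.+1, q.+1)) (i : 'I_p.+1) (j : 'I_q.+1) :
  M i j = ent M i j.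
Proof. by rewrite /ent !leq_ord !inord_val. Qed.

Lemma ent_gtl p q (M : 'M[K]_(p.+1, q.+1)) r s : (p < r)%N -> ent M r s = 0.
Proof. by move=> pr; rewrite /ent leqNgt pr. Qed.

Lemma ent_gtr p q (M : 'M[K]_(p.+1, q.+1)) r s : (q < s)%N -> ent M r s = 0.
Proof. by move=> qs; rewrite /ent andbC leqNgt qs. Qed.

Lemma ent_inj p q (M N : 'M[K]_(p.+1, q.+1)) :
  (forall r s, (r <= p)%N -> (s <= q)%N -> ent M r s = ent N r s) -> M = N.
Proof. by move=> eqMN; apply/matrixP => i j; rewrite !ent_ord eqMN ?leq_ord. Qed.

Lemma ent0 p q r s : ent (0 : 'M[K]_(p.+1, q.+1)) r s = 0.
Proof. by rewrite /ent mxE if_same. Qed.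

Lemma entD p q (M N : 'M[K]_(p.+1, q.+1)) r s :
  ent (M + N) r s = ent M r s + ent N r s.
Proof. by rewrite /ent mxE; case: ifP => // _; rewrite addr0. Qed.

Lemma entZ p q x (M : 'M[K]_(p.+1, q.+1)) r s : ent (x *: M) r s = x * ent M r s.
Proof. by rewrite /ent mxE; case: ifP => // _; rewrite mulr0. Qed.

Lemma ent_sum p q k (F : 'I_k -> 'M[K]_(p.+1, q.+1)) r s :
  ent (\sum_j F j) r s = \sum_j ent (F j) r s.
Proof. by apply: (big_morph (fun M => ent M r s)) => [M N|]; rewrite ?entD ?ent0. Qed.

Lemma ent_tr p q (M : 'M[K]_(p.+1, q.+1)) r s : ent M^T r s = ent M s r.
Proof. by rewrite /ent mxE andbC. Qed.

Lemma ent_mul p q k (M : 'M[K]_(p.+1, k.+1)) (N : 'M[K]_(k.+1, q.+1)) r s :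
  ent (M *m N) r s = \sum_(j < k.+1) ent M r j * ent N j s.
Proof.
rewrite {1}/ent; case: ifP => [/andP[rp sq]|/negbT].
  by rewrite mxE; apply: eq_bigr => j _; rewrite !ent_ord !inordK.
rewrite negb_and -!ltnNge => out; rewrite big1 // => j _.
by case/orP: out => [/ent_gtl|/ent_gtr] ->; rewrite ?mul0r ?mulr0.
Qed.

(** The last premise covers a [j0] beyond the range, so that sums with one surviving term need no
    border case. *)
Lemma sum_ord1 k (f : nat -> K) j0 :
  (forall j, (j <= k)%N -> j <> j0 -> f j = 0) -> ((k < j0)%N -> f j0 = 0) ->
  \sum_(j < k.+1) f j = f j0.
Proof.
move=> f0 fk; have [j0k|kj0] := leqP j0 k; last first.
  by rewrite fk // big1 // => j _; apply: f0; have := ltn_ord j; lia.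
rewrite (bigD1 (inord j0)) //= inordK // big1 ?addr0 // => j jj0.
apply: f0; first by rewrite -ltnS.
by move=> e; case/eqP: jj0; rewrite -e inord_val.
Qed.

Lemma ent_sl2 g k r j : ent (sl2mat K g k) r j =
  if (r <= k)%N && (j <= k)%N then
    match g with
    | gE => if r.+1 == j then (j * (k - j).+1)%:R else 0
    | gF => if r == j.+1 then 1 else 0
    | gH => if r == j then (k%:Z - 2 * j%:Z)%:~R else 0
    end
  else 0.
Proof. by rewrite /ent mxE; case: ifP => // /andP[rk jk]; rewrite !inordK. Qed.

(** The outer test matters at [r = p.+1], where the shifted entry [ent M p s] may be nonzero. *)
Lemma ent_mulFl p q (M : 'M[K]_(p.+1, q.+1)) r s :
  ent (sl2mat K gF p *m M) r s =
  if (r <= p)%N then (if r is r'.+1 then ent M r' s else 0) else 0.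
Proof.
rewrite ent_mul; case: leqP => [rp|pr]; last first.
  by rewrite big1 // => j _; rewrite ent_gtl ?mul0r.
case: r rp => [|r] rp.
  by rewrite big1 // => j _; rewrite ent_sl2; case: ifP; rewrite mul0r.
rewrite (@sum_ord1 _ (fun j => ent (sl2mat K gF p) r.+1 j * ent M j s) r) => [|j jp jr|pr].
- by rewrite ent_sl2 rp eqxx ltnW // mul1r.
- by rewrite ent_sl2 eqSS; case: eqP => [?|_]; [lia|rewrite if_same mul0r].
- by lia.
Qed.

Lemma ent_mulEl p q (M : 'M[K]_(p.+1, q.+1)) r s :
  ent (sl2mat K gE p *m M) r s = (r.+1 * (p - r))%:R * ent M r.+1 s.
Proof.
rewrite ent_mul.
rewrite (@sum_ord1 _ (fun j => ent (sl2mat K gE p) r j * ent M j s) r.+1) => [|j jp jr|pr].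
- rewrite ent_sl2 eqxx; have [rp|pr] := ltnP r p; last by rewrite [ent M _ _]ent_gtl ?mulr0.
  by rewrite ltnW // subnSK.
- by rewrite ent_sl2; case: eqP => [?|_]; [lia|rewrite if_same mul0r].
- by rewrite [ent M _ _]ent_gtl ?mulr0.
Qed.

Lemma ent_mulHl p q (M : 'M[K]_(p.+1, q.+1)) r s :
  ent (sl2mat K gH p *m M) r s = (p%:Z - 2 * r%:Z)%:~R * ent M r s.
Proof.
rewrite ent_mul.
rewrite (@sum_ord1 _ (fun j => ent (sl2mat K gH p) r j * ent M j s) r) => [|j jp jr|pr].
- rewrite ent_sl2 eqxx; have [rp|pr] := leqP r p => //.
  by rewrite [ent M _ _]ent_gtl ?mulr0.
- by rewrite ent_sl2; case: eqP => [?|_]; [lia|rewrite if_same mul0r].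
- by rewrite [ent M _ _]ent_gtl ?mulr0.
Qed.

Lemma ent_mulFr p q (M : 'M[K]_(p.+1, q.+1)) r s : (s <= q)%N ->
  ent (M *m sl2mat K gF q) r s = ent M r s.+1.
Proof.
move=> sq; rewrite ent_mul.
rewrite (@sum_ord1 _ (fun j => ent M r j * ent (sl2mat K gF q) j s) s.+1) => [|j jp jr|qs].
- rewrite ent_sl2 eqxx sq andbT; have [qs|sq'] := ltnP s q; first by rewrite mulr1.
  by rewrite mulr0 ent_gtr.
- by rewrite ent_sl2; case: eqP => [?|_]; [lia|rewrite if_same mulr0].
- by rewrite [ent M _ _]ent_gtr ?mul0r.
Qed.

(** At [s = 0] the coefficient is zero, which makes the default [0.-1 = 0] harmless. *)
Lemma ent_mulEr p q (M : 'M[K]_(p.+1, q.+1)) r s : (s <= q)%N ->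
  ent (M *m sl2mat K gE q) r s = (s * (q - s).+1)%:R * ent M r s.-1.
Proof.
move=> sq; rewrite ent_mul.
rewrite (@sum_ord1 _ (fun j => ent M r j * ent (sl2mat K gE q) j s) s.-1) => [|j jp jr|qs].
- rewrite ent_sl2 sq (leq_trans (leq_pred s)) //=; case: s sq => [|s] sq /=.
    by rewrite mulr0 mul0r.
  by rewrite eqxx mulrC.
- by rewrite ent_sl2; case: eqP => [?|_]; [lia|rewrite if_same mulr0].
- by lia.
Qed.

Lemma ent_mulHr p q (M : 'M[K]_(p.+1, q.+1)) r s :
  ent (M *m sl2mat K gH q) r s = (q%:Z - 2 * s%:Z)%:~R * ent M r s.
Proof.
rewrite ent_mul.
rewrite (@sum_ord1 _ (fun j => ent M r j * ent (sl2mat K gH q) j s) s) => [|j jp jr|qs].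
- rewrite ent_sl2 eqxx; have [sq|qs] := leqP s q; first by rewrite mulrC.
  by rewrite [ent M _ _]ent_gtr ?mul0r ?mulr0.
- by rewrite ent_sl2; case: eqP => [?|_]; [lia|rewrite if_same mulr0].
- by rewrite [ent M _ _]ent_gtr ?mul0r.
Qed.

End Entries.

(** * Explicit entries of the equivariant maps *)

(** The value 0 for [i > m] reflects that f kills the lowest vector x_m, so the recursion coming
    from f also holds at [i = m]. *)
Definition cg_ent {K : fieldType} {m a b : nat}
    (phi : 'I_m.+1 -> 'M[K]_(a.+1, b.+1)) (i r s : nat) : K :=
  if (i <= m)%N then ent (phi (inord i)) r s else 0.

Section Pascal.
Variables (K : fieldType) (Q A : nat) (h : nat -> nat -> nat -> K).
Hypothesis hF : forall p r q, (p <= Q + A)%N -> (r <= A)%N -> (q <= Q)%N ->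
  (if r is r'.+1 then h p r' q else 0) = h p.+1 r q + h p r q.+1.
Hypothesis hQ : forall p r, h p r Q.+1 = 0.

(** Induction on [Q - q], then on [r]: two terms of the recursion are known, and the third follows
    from Pascal's rule with a sign. The recursion is stated for an abstract [h] because invariance
    under f is symmetric in the indices [i] and [s], and either of them may play the part of [p]. *)
Lemma pascal_closed_form p r q : (q <= Q)%N -> (r <= A)%N -> (r + Q = p + q)%N ->
  h p r q = h 0%N 0%N Q * ((-1) ^+ (Q - q) * 'C(p, Q - q)%:R).
Proof.
move=> qQ rA epq; have ep : p = (r + (Q - q))%N by lia.
rewrite ep {p epq ep}; have [d eqd] : exists d, (q + d = Q)%N by exists (Q - q)%N; lia.
have -> : (Q - q = d)%N by lia.
move: {qQ} q eqd r rA; elim: d => [|d IHd] q eqd.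
  have -> : q = Q by lia.
  elim=> [|r IHr] rA; first by rewrite addn0 bin0 expr0 !mulr1.
  have := @hF r r.+1 Q; rewrite hQ addr0 !addn0 => <-; try lia.
  by rewrite addn0 !bin0 in IHr *; apply: IHr; lia.
have eqd1 : (q.+1 + d)%N = Q by lia.
elim=> [|r IHr] rA.
  have := @hF d 0%N q; rewrite !add0n => /(_ _ _ _)/esym/eqP; rewrite addr_eq0 => /(_ _ _ _)/eqP -> ; try lia.
  by have := IHd q.+1 eqd1 0%N rA; rewrite !binn add0n => ->; rewrite exprS; ring.
have := @hF (r.+1 + d)%N r.+1 q; rewrite (IHd q.+1) // => /(_ _ _ _)/esym/eqP.
rewrite -subr_eq0 => H; have {H}/eqP := H ltac:(lia) ltac:(lia) ltac:(lia).
have := IHr ltac:(lia); rewrite -addSnnS => -> H.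
rewrite addnS binS natrD exprS; apply/eqP; rewrite -subr_eq0; apply/eqP.
by rewrite -H exprS; ring.
Qed.

End Pascal.

Section ClebschGordan.
Variables (K : fieldType) (m a b : nat) (phi : 'I_m.+1 -> 'M[K]_(a.+1, b.+1)).
Hypothesis char0 : [pchar K] =i pred0.
Hypothesis phiP : cg_map phi.
Implicit Types i r s : nat.
Local Notation f := (cg_ent phi).

Lemma cg_ent_gtm i r s : (m < i)%N -> f i r s = 0.
Proof. by move=> mi; rewrite /cg_ent leqNgt mi. Qed.

Lemma cg_ent_gtr i r s : (b < s)%N -> f i r s = 0.
Proof. by move=> bs; rewrite /cg_ent ent_gtr ?if_same. Qed.

Lemma cg_ent_equivariant (g : sl2gen) i r s : (i <= m)%N ->
  ent (sl2mat K g a *m phi (inord i)) r s =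
  \sum_(j < m.+1) ent (sl2mat K g m) j i * f j r s +
  ent (phi (inord i) *m sl2mat K g b) r s.
Proof.
move=> im; rewrite phiP.2 entD ent_sum; congr (_ + _); apply: eq_bigr => j _.
by rewrite entZ ent_ord inordK // /cg_ent leq_ord inord_val.
Qed.

Lemma cg_entF i r s : (i <= m)%N -> (r <= a)%N -> (s <= b)%N ->
  (if r is r'.+1 then f i r' s else 0) = f i.+1 r s + f i r s.+1.
Proof.
move=> im ra sb; have fi r' s' : f i r' s' = ent (phi (inord i)) r' s' by rewrite /cg_ent im.
transitivity (ent (sl2mat K gF a *m phi (inord i)) r s).
  by rewrite ent_mulFl ra; case: r {ra}.
rewrite (cg_ent_equivariant _ _ _ im) ent_mulFr // -fi; congr (_ + _).
rewrite (@sum_ord1 _ _ (fun j => ent (sl2mat K gF m) j i * f j r s) i.+1) => [|j jm ji|mi].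
- rewrite ent_sl2 eqxx im andbT; have [mi|mi] := ltnP i m; first by rewrite mul1r.
  by rewrite mul0r cg_ent_gtm.
- by rewrite ent_sl2; case: eqP => [?|_]; [lia|rewrite if_same mul0r].
- by rewrite cg_ent_gtm ?mulr0.
Qed.

Lemma cg_entE i r s : (i <= m)%N -> (s <= b)%N ->
  (r.+1 * (a - r))%:R * f i r.+1 s =
  (i * (m - i).+1)%:R * f i.-1 r s + (s * (b - s).+1)%:R * f i r s.-1.
Proof.
move=> im sb; have := cg_ent_equivariant gE r s im.
rewrite ent_mulEl ent_mulEr // /cg_ent im => ->; congr (_ + _).
rewrite (@sum_ord1 _ _ (fun j => ent (sl2mat K gE m) j i * f j r s) i.-1) => [|j jm ji|mi].
- rewrite ent_sl2 im (leq_trans (leq_pred i)) //= /cg_ent (leq_trans (leq_pred i)) //.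
  by case: i {im} => [|i]; rewrite ?mul0r //= eqxx.
- by rewrite ent_sl2; case: eqP => [?|_]; [lia|rewrite if_same mul0r].
- by lia.
Qed.

Lemma intr_eq0_char0 (z : int) : (z%:~R == 0 :> K) = (z == 0).
Proof.
have nat0 := (pcharf0P K).1 char0.
by case: z => n; rewrite ?NegzE ?mulrNz ?oppr_eq0; apply: nat0.
Qed.

(** Invariance under h multiplies the entry by [a - 2r] on one side and by [(m - 2i) + (b - 2s)] on
    the other; in characteristic zero these integers agree if the entry is nonzero. *)
Lemma cg_ent_weight i r s : f i r s <> 0 -> (m + b + 2 * r = a + 2 * i + 2 * s)%N.
Proof.
move=> f0; have [im|mi] := leqP i m; last by rewrite cg_ent_gtm in f0.
have := cg_ent_equivariant gH r s im; rewrite ent_mulHl ent_mulHr.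
rewrite (@sum_ord1 _ _ (fun j => ent (sl2mat K gH m) j i * f j r s) i) => [|j jm ji|mi].
- rewrite ent_sl2 eqxx im /= => /eqP; move: f0; rewrite /cg_ent im => /eqP f0.
  rewrite -mulrDl -subr_eq0 -mulrBl mulf_eq0 (negPf f0) orbF -intrD -intrB intr_eq0_char0.
  by lia.
- by rewrite ent_sl2; case: eqP => [?|_]; [lia|rewrite if_same mul0r].
- by rewrite cg_ent_gtm ?mulr0.
Qed.

Lemma cg_ent_neq0 :
  ~ (forall i r s, (i <= m)%N -> (r <= a)%N -> (s <= b)%N -> f i r s = 0).
Proof.
move=> f0; have [i /eqP i0] := phiP.1; apply: i0; apply: ent_inj => r s ra sb.
by have := f0 i r s (leq_ord i) ra sb; rewrite /cg_ent leq_ord inord_val ent0.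
Qed.

(** The recursion starts from the edge [s = b], beyond which entries vanish. The scalar is the entry
    taking x_0 and v_b to v_0; if it were zero, the whole map would vanish. *)
Lemma cg_ent_lower : (a + b = m)%N -> exists2 mu, mu != 0 &
  forall i r s, (i <= m)%N -> (r <= a)%N -> (s <= b)%N -> f i r s =
    if (r + b == i + s)%N then mu * ((-1) ^+ (b - s) * 'C(i, b - s)%:R) else 0.
Proof.
move=> abm.
have fE i r s : (i <= m)%N -> (r <= a)%N -> (s <= b)%N -> f i r s =
    if (r + b == i + s)%N then f 0%N 0%N b * ((-1) ^+ (b - s) * 'C(i, b - s)%:R) else 0.
  move=> im ra sb; case: eqP => [e|ne]; last first.
    by apply/eqP/negPn/negP => /eqP/cg_ent_weight; lia.
  apply: (@pascal_closed_form K b a (fun p r q => f p r q)) => // [p r' q|p r'] *.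
    by apply: cg_entF; lia.
  by rewrite cg_ent_gtr.
exists (f 0%N 0%N b) => //; apply/eqP => mu0; apply: cg_ent_neq0 => i r s im ra sb.
by rewrite fE // mu0 mul0r if_same.
Qed.

(** The same recursion with [i] and [s] exchanged: the edge is now [i = m], and the scalar is the
    entry at x_m and v_0. *)
Lemma cg_ent_upper : (a + m = b)%N -> exists2 mu, mu != 0 &
  forall i r s, (i <= m)%N -> (r <= a)%N -> (s <= b)%N -> f i r s =
    if (r + m == i + s)%N then mu * ((-1) ^+ (m - i) * 'C(s, m - i)%:R) else 0.
Proof.
move=> amb.
have fE i r s : (i <= m)%N -> (r <= a)%N -> (s <= b)%N -> f i r s =
    if (r + m == i + s)%N then f m 0%N 0%N * ((-1) ^+ (m - i) * 'C(s, m - i)%:R) else 0.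
  move=> im ra sb; case: eqP => [e|ne]; last first.
    by apply/eqP/negPn/negP => /eqP/cg_ent_weight; lia.
  apply: (@pascal_closed_form K m a (fun p r q => f q r p)) => // [p r' q|p r'|] *.
  - by rewrite addrC; apply: cg_entF; lia.
  - by rewrite cg_ent_gtm.
  - by lia.
exists (f m 0%N 0%N) => //; apply/eqP => mu0; apply: cg_ent_neq0 => i r s im ra sb.
by rewrite fE // mu0 mul0r if_same.
Qed.

Section Cartan.
Hypothesis bma : (b + m = a)%N.

Lemma cg_ent_cartan_supp i r s : (r != i + s)%N -> f i r s = 0.
Proof. by move=> rs; apply/eqP/negPn/negP => /eqP/cg_ent_weight; lia. Qed.

(** Otherwise invariance under e would propagate zero from row [r] to row [r.+1], since the factor
    [r.+1 * (a - r)] is nonzero for [r < a], and the map would be zero. *)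
Lemma cg_ent_cartan_top_neq0 : f 0%N 0%N 0%N != 0.
Proof.
have nat0 := (pcharf0P K).1 char0.
apply/eqP => f0; apply: cg_ent_neq0 => i r s im ra sb.
have [ers|] := eqVneq r (i + s)%N; last exact: cg_ent_cartan_supp.
elim: r i s ers im ra sb => [|r IHr] i s ers im ra sb.
  by have -> : i = 0%N by [lia]; have -> : s = 0%N by lia.
have := cg_entE r im sb.
have -> : (i * (m - i).+1)%:R * f i.-1 r s = 0.
  by case: i {im} ers im => [|i] ers im; rewrite ?mul0r // IHr ?mulr0 //=; lia.
have -> : (s * (b - s).+1)%:R * f i r s.-1 = 0.
  by case: s {sb} ers sb => [|s] ers sb; rewrite ?mul0r // IHr ?mulr0 //=; lia.
by move/eqP; rewrite addr0 mulf_eq0 nat0 muln_eq0 subn_eq0 leqNgt ra => /eqP.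
Qed.

(** As e kills x_0, invariance under e ties two consecutive entries of this family by nonzero
    factors. *)
Lemma cg_ent_cartan_first_neq0 s : (s <= b)%N -> f 0%N s s != 0.
Proof.
have nat0 := (pcharf0P K).1 char0.
elim: s => [|s IHs] sb; first exact: cg_ent_cartan_top_neq0.
have := cg_entE s (leq0n m) sb; rewrite mul0r add0r => /eqP e.
apply: contraTneq (IHs (ltnW sb)) => f0; move: e; rewrite f0 mulr0 eq_sym mulf_eq0.
by rewrite nat0 /= => ->.
Qed.

Lemma cg_ent_cartan_last_neq0 s : (s <= b)%N -> f m (m + s)%N s != 0.
Proof.
have nat0 := (pcharf0P K).1 char0.
elim: s => [|s IHs] sb.
  (* For [s = 0] the same argument climbs in [i], as e kills v_0. The entries with [i = m] are then
     linked by f, which kills x_m. *)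
  rewrite addn0; suff fi i : (i <= m)%N -> f i i 0%N != 0 by apply: fi.
  elim: i => [|i IHi] im; first exact: cg_ent_cartan_top_neq0.
  have := cg_entE i im (leq0n b); rewrite mul0r addr0 => /eqP e.
  apply: contraTneq (IHi (ltnW im)) => f0; move: e; rewrite f0 mulr0 eq_sym mulf_eq0.
  by rewrite nat0 /= => ->.
have := @cg_entF m (m + s).+1 s; rewrite (@cg_ent_gtm m.+1) // add0r addnS => <-; lia.
Qed.

End Cartan.
End ClebschGordan.

(** * The invariance equations, first by blocks and then by entries *)

Section Annihilator.
Variables (K : fieldType) (m a b c d : nat).
Variables (phi1 : 'I_m.+1 -> 'M[K]_(a.+1, b.+1)) (phi2 : 'I_m.+1 -> 'M[K]_(c.+1, d.+1)).

(** With zero diagonal blocks, x_i sends both remaining blocks into V(a) (x) V(c), so each x_i gives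
    a single matrix equation. *)
Lemma S1E (M : 'M[K]_(a.+1 + b.+1, c.+1 + d.+1)) : S1 phi1 phi2 M <->
  [/\ ulsubmx M = 0, drsubmx M = 0 &
      forall i, phi1 i *m dlsubmx M + ursubmx M *m (phi2 i)^T = 0].
Proof.
have actE i : ulsubmx M = 0 -> drsubmx M = 0 -> tensor_act (Ex phi1 i) (Ex phi2 i) M =
    block_mx (phi1 i *m dlsubmx M + ursubmx M *m (phi2 i)^T) 0 0 0.
  move=> ul0 dr0; rewrite -{1}[M]submxK ul0 dr0 /tensor_act /Ex tr_block_mx !mulmx_block.
  by rewrite !trmx0 !(mul0mx, mulmx0, addr0, add0r) add_block_mx !addr0.
split=> [[ul0 [dr0 M0]]|[ul0 dr0 M0]].
  split=> // i; have := M0 i; rewrite actE // -[0 in RHS](@block_mx0 _ a.+1 b.+1 c.+1 d.+1).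
  by case/eq_block_mx.
by do 2![split=> //]; move=> i; rewrite actE // M0 block_mx0.
Qed.

Lemma S1_ent (M : 'M[K]_(a.+1 + b.+1, c.+1 + d.+1)) : S1 phi1 phi2 M <->
  [/\ ulsubmx M = 0, drsubmx M = 0 &
      forall i r t, (i <= m)%N -> (r <= a)%N -> (t <= c)%N ->
        \sum_(j < b.+1) cg_ent phi1 i r j * ent (dlsubmx M) j t +
        \sum_(j < d.+1) cg_ent phi2 i t j * ent (ursubmx M) r j = 0].
Proof.
rewrite S1E; set P := ursubmx M; set Q := dlsubmx M.
have sumE i r t : ent (phi1 i *m Q + P *m (phi2 i)^T) r t =
  \sum_(j < b.+1) cg_ent phi1 i r j * ent Q j t + \sum_(j < d.+1) cg_ent phi2 i t j * ent P r j.
  rewrite entD !ent_mul; congr (_ + _); apply: eq_bigr => j _.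
    by rewrite /cg_ent leq_ord inord_val.
  by rewrite ent_tr mulrC /cg_ent leq_ord inord_val.
split=> [[ul0 dr0 M0]|[ul0 dr0 M0]]; split=> //.
  by move=> i r t im _ _; have := sumE (inord i) r t; rewrite M0 ent0 inordK.
by move=> i; apply: ent_inj => r t ra tc; rewrite sumE M0 ?leq_ord // ent0.
Qed.

End Annihilator.

(** * Vanishing for V_2 = E(d + m, d), and for V_2 = E(c, c + m) with c > 0 *)

Lemma sign_mul_sign (K : fieldType) n : (-1) ^+ n * (-1) ^+ n = 1 :> K.
Proof. by rewrite -expr2 sqrr_sign. Qed.

Section Solutions.
Variables (K : fieldType) (m a b : nat) (phi1 : 'I_m.+1 -> 'M[K]_(a.+1, b.+1)).
Hypothesis char0 : [pchar K] =i pred0.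
Hypothesis phi1P : cg_map phi1.
Hypothesis abm : (a + b = m)%N.

(** Only the column [s = r + b - i] lies on the antidiagonal, where [b - s = i - r] turns the
    binomial into ['C(i, r)]. The test guards the truncated subtraction; for [i < r] the column
    exceeds [b] and the binomial is zero. *)
Lemma cg_ent_lower_sum : exists2 mu, mu != 0 &
  forall i r (X : nat -> K), (i <= m)%N -> (r <= a)%N ->
    \sum_(j < b.+1) cg_ent phi1 i r j * X j =
    if (i <= r + b)%N then mu * ((-1) ^+ (i + r) * 'C(i, r)%:R) * X (r + b - i)%N else 0.
Proof.
have [mu mu0 fE] := cg_ent_lower char0 phi1P abm; exists mu => // i r X im ra.
case: leqP => [irb|rbi]; last first.
  rewrite big1 // => j _; rewrite fE ?leq_ord //; case: eqP => e; last by rewrite mul0r.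
  by move: rbi; rewrite e ltnNge leq_addr.
have [ri|ir] := leqP r i; last first.
  rewrite bin_small // !mulr0 mul0r big1 // => j _; rewrite fE ?leq_ord //.
  by case: eqP => e; rewrite ?mul0r //; have := leq_ord j; lia.
rewrite (@sum_ord1 _ _ (fun j => cg_ent phi1 i r j * X j) (r + b - i)) => [|j jb ne|]; last by lia.
  rewrite fE //; last by lia.
  have -> : (r + b == i + (r + b - i))%N by lia.
  have -> : (b - (r + b - i) = i - r)%N by lia.
  rewrite bin_sub //; congr (_ * (_ * _) * _).
  by rewrite -[in RHS](subnK ri) !exprD -mulrA sign_mul_sign mulr1.
by rewrite fE //; case: eqP => e; [lia|rewrite mul0r].
Qed.

Lemma sub_block0 (c d : nat) (M : 'M[K]_(a.+1 + b.+1, c.+1 + d.+1)) :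
  ulsubmx M = 0 -> drsubmx M = 0 -> ursubmx M = 0 -> dlsubmx M = 0 -> M = 0.
Proof. by move=> ul dr ur dl; rewrite -[M]submxK ul dr ur dl block_mx0. Qed.

Section CartanCase.
Variables (c d : nat) (phi2 : 'I_m.+1 -> 'M[K]_(c.+1, d.+1)).
Hypothesis phi2P : cg_map phi2.
Hypothesis dmc : (d + m = c)%N.
Hypothesis a_gt0 : (0 < a)%N.

(** The index [i] is chosen to remove the term in the lower left block: [i = m > b] for row 0, and
    [i = 0] for rows [r > 0], where ['C(0, r) = 0]. A nonvanishing Cartan entry then kills the upper
    right block, and the equations of row 0 kill the other one. *)
Lemma S1_cartan_eq0 : is_zero_sub (S1 phi1 phi2).
Proof.
move=> M /S1_ent[ul dr eqM]; have [mu mu0 sumE] := cg_ent_lower_sum.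
have P0 r u : (r <= a)%N -> (u <= d)%N -> ent (ursubmx M) r u = 0.
  have sum2 i t : t = (i + u)%N -> \sum_(j < d.+1) cg_ent phi2 i t j * ent (ursubmx M) r j =
      cg_ent phi2 i t u * ent (ursubmx M) r u.
    move=> ->; apply: (@sum_ord1 _ _ (fun j => cg_ent phi2 i _ j * ent (ursubmx M) r j) u).
      by move=> j jd ju; rewrite (cg_ent_cartan_supp char0 phi2P dmc) ?mul0r //; apply/eqP; lia.
    by move=> du; rewrite cg_ent_gtr ?mul0r.
  case: r sum2 => [|r] sum2 ra ud.
    have := eqM m 0%N (m + u)%N (leqnn m) ra ltac:(lia).
    rewrite (sumE _ _ (ent (dlsubmx M) ^~ (m + u)%N)) // sum2 // ifF ?add0r; last by lia.
    move/eqP; rewrite mulf_eq0 => /orP[f0|/eqP //].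
    by have := cg_ent_cartan_last_neq0 char0 phi2P dmc ud; rewrite f0.
  have := eqM 0%N r.+1 u (leq0n m) ra ltac:(lia).
  rewrite (sumE _ _ (ent (dlsubmx M) ^~ u)) // sum2 // bin_small // !mulr0 mul0r leq0n add0r.
  move/eqP; rewrite mulf_eq0 => /orP[f0|/eqP //].
  by have := cg_ent_cartan_first_neq0 char0 phi2P dmc ud; rewrite f0.
apply: sub_block0 => //; first by apply: ent_inj => r u ra ud; rewrite P0 // ent0.
apply: ent_inj => s t sb tc.
have := eqM (b - s)%N 0%N t ltac:(lia) (leq0n a) tc.
rewrite (sumE _ _ (ent (dlsubmx M) ^~ t)) //; last by lia.
rewrite [X in _ + X]big1 => [|j _]; last by rewrite P0 ?mulr0 // leq_ord.
rewrite ifT ?bin0 ?mulr1 ?addr0; last by lia.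
have -> : (0 + b - (b - s) = s)%N by lia.
by rewrite ent0 => /eqP; rewrite !mulf_eq0 (negPf mu0) signr_eq0 => /eqP.
Qed.

End CartanCase.

Section UpperCase.
Variables (c d : nat) (phi2 : 'I_m.+1 -> 'M[K]_(c.+1, d.+1)).
Hypothesis phi2P : cg_map phi2.
Hypothesis cmd : (c + m = d)%N.
Hypothesis a_gt0 : (0 < a)%N.
Hypothesis c_gt0 : (0 < c)%N.

Lemma cg_ent_upper_sum : exists2 mu, mu != 0 &
  forall i t (X : nat -> K), (i <= m)%N -> (t <= c)%N ->
    \sum_(j < d.+1) cg_ent phi2 i t j * X j =
    mu * ((-1) ^+ i * 'C(m - i + t, t)%:R) * X (m - i + t)%N.
Proof.
have [mu mu0 fE] := cg_ent_upper char0 phi2P cmd.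
(* The factor [(-1) ^+ m] turns the sign [(-1) ^+ (m - i)] into [(-1) ^+ i], the sign common to both
   sums. *)
exists (mu * (-1) ^+ m); first by rewrite mulf_neq0 ?signr_eq0.
move=> i t X im tc.
rewrite (@sum_ord1 _ _ (fun j => cg_ent phi2 i t j * X j) (m - i + t)) => [|j jb ne|]; last by lia.
  rewrite fE //; last by lia.
  have -> : (t + m == i + (m - i + t))%N by lia.
  have -> : 'C(m - i + t, m - i) = 'C(m - i + t, t).
    by rewrite -bin_sub ?leq_addr // addKn.
  rewrite -!mulrA; congr (_ * _); rewrite [in RHS]mulrA; congr (_ * _).
  by rewrite -[in RHS](subnK im) exprD -mulrA sign_mul_sign mulr1.
by rewrite fE //; case: eqP => e; [lia|rewrite mul0r].
Qed.

(** Eliminating the upper right block leaves a recursion on the lower left one, whose instances in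
    rows 0 and 1 are incompatible unless the entries vanish; this is where [a > 0] enters. *)
Lemma S1_upper_eq0 : is_zero_sub (S1 phi1 phi2).
Proof.
have nat0 := (pcharf0P K).1 char0.
move=> M /S1_ent[ul dr eqM]; have [mu1 mu1_0 sum1] := cg_ent_lower_sum.
have [mu2 mu2_0 sum2] := cg_ent_upper_sum.
pose X i r t := if (i <= r + b)%N then 'C(i, r)%:R * ent (dlsubmx M) (r + b - i) t else 0.
have XE i r t : (i <= m)%N -> (r <= a)%N -> (t <= c)%N ->
    mu1 * (-1) ^+ r * X i r t + mu2 * 'C(m - i + t, t)%:R * ent (ursubmx M) r (m - i + t) = 0.
  move=> im ra tc; have := eqM i r t im ra tc.
  rewrite (sum1 _ _ (ent (dlsubmx M) ^~ t)) // (sum2 _ _ (ent (ursubmx M) r)) // /X => /eqP.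
  rewrite -(inj_eq (mulfI (negbT (signr_eq0 K i)))) => /eqP e.
  apply: etrans (etrans e _); last by rewrite mulr0.
  rewrite mulrDr; congr (_ + _); last by rewrite -[LHS](signrMK i); congr (_ * _); ring.
  case: ifP => _; last by rewrite !mulr0.
  by rewrite -[LHS](signrMK i); congr (_ * _); rewrite exprD; ring.
(* The equations for (i, t) and (i.+1, t.+1) involve the same entry of [ursubmx M]. *)
have step i r t : (i < m)%N -> (r <= a)%N -> (t < c)%N ->
    (m - i)%:R * X i r t = t.+1%:R * X i.+1 r t.+1.
  move=> im ra tc; have e1 := XE i r t (ltnW im) ra (ltnW tc).
  have := XE i.+1 r t.+1 im ra tc.
  have -> : (m - i.+1 + t.+1 = m - i + t)%N by lia.
  move=> e2; apply/eqP; rewrite -subr_eq0.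
  suff : mu1 * (-1) ^+ r * ((m - i)%:R * X i r t - t.+1%:R * X i.+1 r t.+1) == 0.
    by rewrite !mulf_eq0 (negPf mu1_0) signr_eq0.
  have eb : (t.+1 * 'C(m - i + t, t.+1))%:R = ((m - i) * 'C(m - i + t, t))%:R :> K.
    by rewrite mul_bin_left addnK.
  rewrite !natrM in eb; apply/eqP.
  set p := ent (ursubmx M) _ _ in e1 e2.
  transitivity ((m - i)%:R * (mu1 * (-1) ^+ r * X i r t + mu2 * 'C(m - i + t, t)%:R * p)
    - t.+1%:R * (mu1 * (-1) ^+ r * X i.+1 r t.+1 + mu2 * 'C(m - i + t, t.+1)%:R * p)
    + mu2 * p * (t.+1%:R * 'C(m - i + t, t.+1)%:R - (m - i)%:R * 'C(m - i + t, t)%:R)).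
    by ring.
  by rewrite e1 e2 eb subrr !mulr0 subrr addr0.
(* Rows 0 and 1 give two relations between the same entries [x] and [y]. Eliminating [y] leaves [x]
   with the coefficient [(s + 2)(m - s) - (s + 1)(m - s - 1) = m + 1]. *)
have two s t : (s < b)%N -> (t < c)%N -> ent (dlsubmx M) (b - s) t = 0.
  move=> sb tc; have := @step s 0%N t; have := @step s.+1 1%N t.
  rewrite /X !ifT; try lia.
  rewrite !bin0 !bin1 !mul1r.
  have -> : (1 + b - s.+1 = b - s)%N by lia.
  have -> : (1 + b - s.+2 = 0 + b - s.+1)%N by lia.
  have -> : (0 + b - s = b - s)%N by lia.
  set x := ent _ _ t; set y := ent _ _ t.+1 => e1 e2.
  have {}e1 := e1 ltac:(lia) ltac:(lia) ltac:(lia).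
  have {}e2 := e2 ltac:(lia) ltac:(lia) ltac:(lia).
  have ems : (m - s)%:R = (m - s.+1)%:R + 1 :> K by rewrite natr1; congr _%:R; lia.
  have em : m.+1%:R = (m - s.+1)%:R + s.+2%:R :> K by rewrite -natrD; congr _%:R; lia.
  suff : m.+1%:R * x == 0 by rewrite mulf_eq0 nat0 => /eqP.
  apply/eqP; transitivity (s.+2%:R * ((m - s)%:R * x) - (m - s.+1)%:R * (s.+1%:R * x)).
    by rewrite ems em -[s.+2%:R]natr1; ring.
  by rewrite e1 e2; ring.
(* There remain the column [t = c] and the row [s = 0]. The column follows from the previous one by
   [step], with its corner [s = b] obtained from ['C(0, 1) = 0]; in the row, the right side of
   [step] at [i = b] is out of range. *)
have Q0 s t : (s <= b)%N -> (t <= c)%N -> ent (dlsubmx M) s t = 0.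
  move=> sb; rewrite leq_eqVlt => /orP[/eqP tc|tc].
    case: t tc => [|t] tc; first by lia.
    have [->|sb'] := eqVneq s b.
      have := @step 0%N 1%N t ltac:(lia) a_gt0 ltac:(lia); rewrite /X leq0n add1n ltn0Sn.
      rewrite bin_small // mul0r mulr0 bin1 mul1r subn1 => /esym/eqP.
      by rewrite mulf_eq0 nat0 => /eqP.
    have := @step (b - s.+1)%N 0%N t ltac:(lia) (leq0n a) ltac:(lia).
    rewrite /X !ifT; try lia.
    rewrite !bin0 !mul1r; have -> : (0 + b - (b - s.+1).+1 = s)%N by lia.
    rewrite add0n two ?mulr0; try lia.
    by move/esym/eqP; rewrite mulf_eq0 nat0 => /eqP.
  case: s sb => [|s] sb; last first.
    by have -> : s.+1 = (b - (b - s.+1))%N by [lia]; apply: two; lia.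
  have := @step b 0%N t ltac:(lia) (leq0n a) tc; rewrite /X ifT // ifF; last by lia.
  rewrite bin0 mul1r mulr0 add0n subnn => /eqP; rewrite mulf_eq0 nat0.
  by have -> : (m - b == 0)%N = false by [lia]; move/eqP.
apply: sub_block0 => //; last by apply: ent_inj => r u ra ud; rewrite Q0 // ent0.
apply: ent_inj => r w ra wd; rewrite ent0.
(* Every column of the upper right block occurs in some equation: [t = 0] reaches those up to [m],
   and [i = 0] the others. *)
have [i [t [im tc ew]]] : exists i t, [/\ (i <= m)%N, (t <= c)%N & (m - i + t = w)%N].
  have [wm|mw] := leqP w m; first by exists (m - w)%N, 0%N; split; lia.
  by exists 0%N, (w - m)%N; split; lia.
have := XE i r t im ra tc; rewrite /X.
have -> : (if (i <= r + b)%N then 'C(i, r)%:R * ent (dlsubmx M) (r + b - i) t else 0) = 0.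
  case: ifP => // irb; have [ri|ir] := leqP r i; last by rewrite bin_small ?mul0r.
  by rewrite Q0 ?mulr0 //; lia.
rewrite mulr0 add0r ew => /eqP; rewrite !mulf_eq0 (negPf mu2_0) nat0 /= eqn0Ngt bin_gt0.
by rewrite -ew leq_addl /= => /eqP.
Qed.

End UpperCase.
End Solutions.

(** * Binomial identities and the sl(2)-action on the copy of V(d - a) *)

(** Both sides count the ordered pairs of disjoint subsets of sizes [r] and [t] in a set of [i]
    elements. *)
Lemma bin_mul_binC i r t :
  ('C(i, r) * 'C(i - r, t) = 'C(i, t) * 'C(i - t, r))%N.
Proof.
have [rti|irt] := leqP (r + t) i; last first.
  have z x y : (i < x + y)%N -> ('C(i, x) * 'C(i - x, y) = 0)%N.
    move=> ixy; have [xi|ix] := leqP x i; last by rewrite bin_small.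
    by rewrite (@bin_small (i - x)) ?muln0 //; lia.
  by rewrite !z // addnC.
have multinomial x y : (x + y <= i)%N ->
    ('C(i, x) * 'C(i - x, y) * (x`! * y`! * (i - (x + y))`!) = i`!)%N.
  move=> xyi; have yix : (y <= i - x)%N by lia.
  have xi : (x <= i)%N by lia.
  by have := bin_fact yix; have := bin_fact xi; rewrite subnDA => <- <-; ring.
have pos : (0 < r`! * t`! * (i - (r + t))`!)%N by rewrite !muln_gt0 !fact_gt0.
apply/eqP; rewrite -(eqn_pmul2r pos) multinomial //; apply/eqP.
by rewrite -(@multinomial t r) 1?addnC // [(t`! * _)%N]mulnC.
Qed.

(* The copy of V(d - a) in V(a) (x) V(d): the j-th matrix is its vector f^j w,
   where w is the highest weight vector. *)
Definition cg_basis (K : fieldType) (a d j : nat) : 'M[K]_(a.+1, d.+1) :=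
  \matrix_(r < a.+1, u < d.+1)
    if (r + u == a + j)%N then (-1) ^+ r * 'C(d - u, r)%:R else 0.

Section CGBasis.
Variable K : fieldType.
Implicit Types a d j r u : nat.

Lemma ent_cg_basis a d j r u : (r <= a)%N -> (u <= d)%N ->
  ent (cg_basis K a d j) r u =
  if (r + u == a + j)%N then (-1) ^+ r * 'C(d - u, r)%:R else 0.
Proof. by move=> ra ud; rewrite /ent ra ud mxE !inordK. Qed.

(** On the support [r + u = a + j > d], hence [r > d - u] and the binomial is zero: the string
    generated by f stops after [d - a] steps. *)
Lemma cg_basis_small a d j : (a <= d)%N -> (d - a < j)%N -> cg_basis K a d j = 0.
Proof.
move=> ad daj; apply: ent_inj => r u ra ud; rewrite ent_cg_basis // ent0.
by case: eqP => // e; rewrite bin_small ?mulr0 //; lia.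
Qed.

Lemma ent_sum_cg_basis a d (x : nat -> K) r u : (a <= d)%N -> (r <= a)%N -> (u <= d)%N ->
  ent (\sum_(j < (d - a).+1) x j *: cg_basis K a d j) r u =
  if (a <= r + u)%N then x (r + u - a)%N * ((-1) ^+ r * 'C(d - u, r)%:R) else 0.
Proof.
move=> ad ra ud; rewrite ent_sum.
under eq_bigr do rewrite entZ ent_cg_basis //.
have [aru|rua] := leqP a (r + u); last first.
  by rewrite big1 // => j _; case: eqP => e; [lia|rewrite mulr0].
rewrite (@sum_ord1 _ _ (fun j => x j *
  (if (r + u == a + j)%N then (-1) ^+ r * 'C(d - u, r)%:R else 0)) (r + u - a)).
- by rewrite ifT //; lia.
- move=> j jd ne; case: eqP => [e|_]; last by rewrite mulr0.
  by move: ne; rewrite e addKn.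
- move=> dru; case: eqP => [e|_]; last by rewrite mulr0.
  by rewrite bin_small ?mulr0 //; lia.
Qed.

(** The case of f is Pascal's rule and that of h compares weights. For e, both terms are multiples
    of [r.+1 * 'C(d - u, r.+1)], and the support condition reduces their combined factor to [j]. *)
Lemma cg_basis_act g a d j : (a <= d)%N -> (j <= d - a)%N ->
  sl2mat K g a *m cg_basis K a d j + cg_basis K a d j *m (sl2mat K g d)^T =
  \sum_(l < (d - a).+1) ent (sl2mat K g (d - a)) l j *: cg_basis K a d l.
Proof.
move=> ad jda; apply: ent_inj => r u ra ud.
have rhsE l0 : (forall l, (l <= d - a)%N -> l <> l0 -> ent (sl2mat K g (d - a)) l j = 0) ->
    ent (\sum_(l < (d - a).+1) ent (sl2mat K g (d - a)) l j *: cg_basis K a d l) r u =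
    ent (sl2mat K g (d - a)) l0 j * ent (cg_basis K a d l0) r u.
  move=> l0P; rewrite ent_sum; under eq_bigr do rewrite entZ.
  apply: (@sum_ord1 _ _ (fun l => ent (sl2mat K g (d - a)) l j * ent (cg_basis K a d l) r u)).
    by move=> l ld ne; rewrite l0P // mul0r.
  by move=> dl; rewrite ent_gtl // mul0r.
have lhsE : ent (cg_basis K a d j *m (sl2mat K g d)^T) r u =
    ent (sl2mat K g d *m (cg_basis K a d j)^T) u r.
  by rewrite -ent_tr trmx_mul trmxK.
rewrite entD lhsE; case: g rhsE {lhsE} => rhsE.
- rewrite !ent_mulEl ent_tr (rhsE j.-1) => [|l ld ne]; last first.
    by rewrite ent_sl2; case: eqP => [e|_]; [lia|rewrite if_same].
  rewrite ent_sl2 jda (leq_trans (leq_pred j)) //=.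
  rewrite (@ent_cg_basis a d j.-1 r u) //.
  have [eru|ne] := eqVneq (r + u).+1 (a + j)%N; last first.
    have z r' u' : (r' + u' = (r + u).+1)%N -> ent (cg_basis K a d j) r' u' = 0.
      move=> e; rewrite /ent mxE; case: ifP => // /andP[ra' ud'].
      by rewrite !inordK // e (negPf ne).
    rewrite !z ?mulr0 ?addr0; try lia.
    case: j jda ne {rhsE z} => [|j] jda ne; first by rewrite mul0r.
    by move: ne; rewrite addnS eqSS /= => /negPf ->; rewrite mulr0.
  have t1 : (r.+1 * (a - r))%:R * ent (cg_basis K a d j) r.+1 u =
      (r.+1 * (a - r))%:R * ((-1) ^+ r.+1 * 'C(d - u, r.+1)%:R).
    have [ra'|ar] := ltnP r a; first by rewrite ent_cg_basis // ifT //; lia.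
    by have -> : (a - r = 0)%N by [lia]; rewrite muln0 !mul0r.
  have t2 : (u.+1 * (d - u))%:R * ent (cg_basis K a d j) r u.+1 =
      (u.+1 * (d - u))%:R * ((-1) ^+ r * 'C(d - u.+1, r)%:R).
    have [ud'|du] := ltnP u d; first by rewrite ent_cg_basis // ifT //; lia.
    by have -> : (d - u = 0)%N by [lia]; rewrite muln0 !mul0r.
  rewrite t1 t2 {t1 t2 rhsE}.
  have -> : (d - u.+1 = (d - u).-1)%N by lia.
  have b1 : ((d - u) * 'C((d - u).-1, r) = r.+1 * 'C(d - u, r.+1))%N := mul_bin_diag _ _.
  have b2 : (r.+1 * 'C(d - u, r.+1) = (d - u - r) * 'C(d - u, r))%N := mul_bin_left _ _.
  have eu : (a + j = r + u.+1)%N by lia.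
  transitivity ((-1) ^+ r * (r.+1 * 'C(d - u, r.+1))%:R * (u.+1%:R - (a - r)%:R) : K).
    rewrite mulrBr -{1}b1 !natrM exprS; ring.
  rewrite b2 natrM (natrB _ ra).
  have -> : u.+1%:R = a%:R + j%:R - r%:R :> K by rewrite -natrD eu natrD; ring.
  case: j jda eru eu => [|j] jda eru eu; first by rewrite /= mul0r; ring.
  have eaj : (r + u == a + j)%N by lia.
  rewrite /= eqxx eaj.
  have -> : (d - u - r = (d - a - j.+1).+1)%N by lia.
  by rewrite natrM; ring.
- rewrite !ent_mulFl ra ud (rhsE j.+1) => [|l ld ne]; last first.
    by rewrite ent_sl2; case: eqP => [e|_]; [lia|rewrite if_same].
  have -> : ent (sl2mat K gF (d - a)) j.+1 j * ent (cg_basis K a d j.+1) r u =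
      ent (cg_basis K a d j.+1) r u.
    rewrite ent_sl2 eqxx jda andbT; case: ltnP => jd; first by rewrite mul1r.
    by rewrite (@cg_basis_small a d j.+1) // ent0 mul0r.
  rewrite {rhsE} ent_cg_basis //.
  case: r ra => [|r] ra; case: u ud => [|u] ud.
  + by rewrite addr0 ifF //; lia.
  + by rewrite add0r ent_tr ent_cg_basis ?(ltnW ud) // !bin0 !addnS eqSS.
  + by rewrite addr0 ent_cg_basis ?(ltnW ra) // !ifF //; lia.
  rewrite ent_tr !ent_cg_basis ?(ltnW ra) ?(ltnW ud) //.
  have -> : (r + u.+1 == a + j)%N = (r.+1 + u.+1 == a + j.+1)%N by lia.
  have -> : (r.+1 + u == a + j)%N = (r.+1 + u.+1 == a + j.+1)%N by lia.
  case: ifP => _; last by rewrite addr0.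
  have -> : (d - u = (d - u.+1).+1)%N by lia.
  by rewrite binS natrD exprS; ring.
rewrite !ent_mulHl ent_tr (rhsE j) => [|l ld ne]; last first.
  by rewrite ent_sl2; case: eqP => [e|_]; [lia|rewrite if_same].
rewrite ent_sl2 eqxx jda /= -mulrDl -intrD.
rewrite ent_cg_basis //; case: eqP => [e|_]; last by rewrite !mulr0.
by congr (_%:~R * _); lia.
Qed.

End CGBasis.

(** * Solution of the two-term equations for c + d = m *)

Section LowerSystem.
Variables (K : fieldType) (m a b c d : nat).
Hypothesis char0 : [pchar K] =i pred0.
Hypotheses (abm : (a + b = m)%N) (cdm : (c + d = m)%N).
Variables (mu1 mu2 : K).
Hypotheses (mu1_neq0 : mu1 != 0) (mu2_neq0 : mu2 != 0).

(** The common sign [(-1) ^+ i] is divided out, and [mu1], [mu2] are the scalars of the two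
    equivariant maps. *)
Definition lower_system (P : 'M[K]_(a.+1, d.+1)) (Q : 'M[K]_(b.+1, c.+1)) :=
  forall i r t, (i <= m)%N -> (r <= a)%N -> (t <= c)%N ->
    (if (i <= r + b)%N then mu1 * ((-1) ^+ r * 'C(i, r)%:R) * ent Q (r + b - i) t else 0) +
    (if (i <= t + d)%N then mu2 * ((-1) ^+ t * 'C(i, t)%:R) * ent P r (t + d - i) else 0) = 0.

Section Solve.
Variables (P : 'M[K]_(a.+1, d.+1)) (Q : 'M[K]_(b.+1, c.+1)).
Hypothesis sysPQ : lower_system P Q.

Lemma lower_system_vanish u : (u < a)%N -> ent P 0 u = 0.
Proof.
move=> ua; have [ud|du] := leqP u d; last by rewrite ent_gtr.
(* As [u < a], the index [m - u] exceeds [b], so the term in [Q] is absent. *)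
have := @sysPQ (m - u)%N 0%N c ltac:(lia) (leq0n a) (leqnn c).
have -> : (m - u <= 0 + b)%N = false by lia.
have -> : (m - u <= c + d)%N by lia.
have -> : (c + d - (m - u) = u)%N by lia.
rewrite add0r => /eqP; rewrite !mulf_eq0 (negPf mu2_neq0) signr_eq0 /=.
rewrite ((pcharf0P K).1 char0) eqn0Ngt bin_gt0.
by have -> : (c <= m - u)%N by [lia]; move/eqP.
Qed.

Lemma lower_systemQ s t : (s <= b)%N -> (t <= c)%N ->
  mu1 * ent Q s t = - (mu2 * ((-1) ^+ t * 'C(b - s, t)%:R *
    (if (b <= s + t + d)%N then ent P 0 (s + t + d - b) else 0))).
Proof.
move=> sb tc; have := @sysPQ (b - s)%N 0%N t ltac:(lia) (leq0n a) tc.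
have -> : (b - s <= 0 + b)%N by lia.
have -> : (b - s <= t + d)%N = (b <= s + t + d)%N by lia.
have -> : (t + d - (b - s) = s + t + d - b)%N by lia.
have -> : (0 + b - (b - s) = s)%N by lia.
rewrite bin0 expr0 !mulr1 => /eqP; rewrite addr_eq0 => /eqP ->.
by case: ifP => _; [ring | rewrite !mulr0].
Qed.

(** The equation with [t = 0] and [i = d - u] isolates this entry in terms of column 0 of [Q], which
    row 0 of [P] determines in turn. Row 0 thus determines the whole solution. *)
Lemma lower_systemP r u : (r <= a)%N -> (u <= d)%N ->
  ent P r u = ent P 0 (r + u) * ((-1) ^+ r * 'C(d - u, r)%:R).
Proof.
move=> ra ud; have := @sysPQ (d - u)%N r 0%N ltac:(lia) ra (leq0n c).
have -> : (d - u <= 0 + d)%N by lia.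
have -> : (0 + d - (d - u) = u)%N by lia.
rewrite bin0 expr0 !mulr1 => e; apply: (mulfI mu2_neq0).
move/eqP: e; rewrite addrC addr_eq0 => /eqP ->.
have [rdu|dur] := leqP r (d - u); last by rewrite bin_small // !(mulr0, mul0r) if_same oppr0.
case: leqP => [durb|rbdu].
  have -> : mu1 * ((-1) ^+ r * 'C(d - u, r)%:R) * ent Q (r + b - (d - u)) 0 =
      (-1) ^+ r * 'C(d - u, r)%:R * (mu1 * ent Q (r + b - (d - u)) 0) by ring.
  rewrite lower_systemQ ?bin0 ?expr0 ?ifT //; try lia.
  by have -> : (r + b - (d - u) + 0 + d - b = r + u)%N by [lia]; ring.
by rewrite lower_system_vanish ?mul0r ?mulr0 ?oppr0 //; lia.
Qed.

Lemma lower_system_eq0 : (d < a)%N -> P = 0 /\ Q = 0.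
Proof.
move=> da; have P0 u : ent P 0 u = 0.
  by have [ua|au] := ltnP u a; [rewrite lower_system_vanish | rewrite ent_gtr //; lia].
split; apply: ent_inj => r u ra ud; rewrite ent0; first by rewrite lower_systemP // P0 mul0r.
by apply: (mulfI mu1_neq0); rewrite lower_systemQ // P0 if_same !mulr0 oppr0.
Qed.

(** Row 0 of the [j]-th basis matrix has a single entry 1, at column [a + j]; the coordinates are
    therefore read off in row 0 of [P]. *)
Lemma lower_system_span : (a <= d)%N ->
  P = \sum_(j < (d - a).+1) ent P 0 (a + j) *: cg_basis K a d j /\
  Q = - (mu2 / mu1) *: (\sum_(j < (d - a).+1) ent P 0 (a + j) *: cg_basis K c b j)^T.
Proof.
move=> ad; split; apply: ent_inj.
  move=> r u ra ud; rewrite (@ent_sum_cg_basis _ a d (fun j => ent P 0 (a + j))) //.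
  rewrite lower_systemP //; case: leqP => [aru|rua]; first by rewrite subnKC.
  by rewrite lower_system_vanish // mul0r.
move=> s t sb tc; apply: (mulfI mu1_neq0).
have ebc : (d - a = b - c)%N by lia.
rewrite entZ ent_tr ebc (@ent_sum_cg_basis _ c b (fun j => ent P 0 (a + j))) //; last by lia.
rewrite lower_systemQ //.
have [bst|stb] := ltnP b (t + s).
  by rewrite bin_small ?(mulr0, mul0r, oppr0, if_same) //; lia.
have [cts|tsc] := leqP c (t + s).
  rewrite ifT; last by lia.
  have -> : (a + (t + s - c) = s + t + d - b)%N by lia.
  by field.
case: leqP => [le|_]; last by rewrite !mulr0 oppr0.
by rewrite lower_system_vanish ?mulr0 ?oppr0 //; lia.
Qed.

End Solve.

Lemma cg_basis_lower_system j : (a <= d)%N -> (j <= d - a)%N ->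
  lower_system (cg_basis K a d j) (- (mu2 / mu1) *: (cg_basis K c b j)^T).
Proof.
move=> ad jda i r t im ra tc.
have [rti|irt] := leqP (r + t) i; last first.
  have -> : (if (i <= r + b)%N then mu1 * ((-1) ^+ r * 'C(i, r)%:R) *
      ent (- (mu2 / mu1) *: (cg_basis K c b j)^T) (r + b - i) t else 0) = 0.
    case: leqP => // irb; have [ri|ir] := leqP r i; last by rewrite bin_small // !(mulr0, mul0r).
    rewrite entZ ent_tr ent_cg_basis //; last by lia.
    by rewrite (@bin_small (b - _)) ?(mulr0, if_same) //; lia.
  rewrite add0r; case: leqP => // itd; have [ti|it] := leqP t i; last by rewrite bin_small // !(mulr0, mul0r).
  rewrite ent_cg_basis //; last by lia.
  by rewrite (@bin_small (d - _)) ?(mulr0, if_same) //; lia.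
rewrite entZ ent_tr; case: leqP => [irb|rbi]; case: leqP => [itd|tdi].
- rewrite !ent_cg_basis //; try lia.
  (* The two supports coincide because [a + b = c + d]; the equation then becomes [bin_mul_binC]. *)
  have -> : (t + (r + b - i) == c + j)%N = (r + (t + d - i) == a + j)%N by lia.
  case: ifP => _; last by rewrite !mulr0 addr0.
  have -> : (b - (r + b - i) = i - r)%N by lia.
  have -> : (d - (t + d - i) = i - t)%N by lia.
  have e : 'C(i, r)%:R * 'C(i - r, t)%:R = 'C(i, t)%:R * 'C(i - t, r)%:R :> K.
    by rewrite -!natrM bin_mul_binC.
  transitivity (mu2 * (-1) ^+ r * (-1) ^+ t *
    ('C(i, t)%:R * 'C(i - t, r)%:R - 'C(i, r)%:R * 'C(i - r, t)%:R)); first by field.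
  by rewrite e subrr mulr0.
- rewrite ent_cg_basis //; last by lia.
  by rewrite ifF ?(mulr0, addr0) //; lia.
- rewrite ent_cg_basis //; last by lia.
  by rewrite ifF ?(mulr0, addr0) //; lia.
by rewrite addr0.
Qed.

End LowerSystem.

(** * The invariants for c + d = m as an sl(2)-module *)

Section LowerCase.
Variables (K : fieldType) (m a b c d : nat).
Hypothesis char0 : [pchar K] =i pred0.
Hypotheses (abm : (a + b = m)%N) (cdm : (c + d = m)%N).
Variables (phi1 : 'I_m.+1 -> 'M[K]_(a.+1, b.+1)) (phi2 : 'I_m.+1 -> 'M[K]_(c.+1, d.+1)).
Hypotheses (phi1P : cg_map phi1) (phi2P : cg_map phi2).

Lemma S1_lower_system : exists mu1 mu2, [/\ mu1 != 0, mu2 != 0 &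
  forall M, S1 phi1 phi2 M <-> [/\ ulsubmx M = 0, drsubmx M = 0 &
    lower_system m mu1 mu2 (ursubmx M) (dlsubmx M)]].
Proof.
have [mu1 mu1_neq0 sum1] := cg_ent_lower_sum char0 phi1P abm.
have [mu2 mu2_neq0 sum2] := cg_ent_lower_sum char0 phi2P cdm.
exists mu1, mu2; split=> // M; rewrite S1_ent.
have eqE i r t : (i <= m)%N -> (r <= a)%N -> (t <= c)%N ->
    \sum_(j < b.+1) cg_ent phi1 i r j * ent (dlsubmx M) j t +
    \sum_(j < d.+1) cg_ent phi2 i t j * ent (ursubmx M) r j =
    (-1) ^+ i * ((if (i <= r + b)%N
       then mu1 * ((-1) ^+ r * 'C(i, r)%:R) * ent (dlsubmx M) (r + b - i) t else 0) +
     (if (i <= t + d)%N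
       then mu2 * ((-1) ^+ t * 'C(i, t)%:R) * ent (ursubmx M) r (t + d - i) else 0)).
  move=> im ra tc.
  rewrite (sum1 _ _ (ent (dlsubmx M) ^~ t)) // (sum2 _ _ (ent (ursubmx M) r)) //.
  by rewrite !exprD mulrDr; congr (_ + _); case: ifP => _; rewrite ?mulr0 //; ring.
split=> [[ul dr eqM]|[ul dr eqM]]; split=> // i r t im ra tc.
  have := eqM i r t im ra tc; rewrite eqE // => /eqP.
  by rewrite mulf_eq0 signr_eq0 => /eqP.
by rewrite eqE // eqM ?mulr0.
Qed.

Lemma S1_lower_eq0 : (d < a)%N -> is_zero_sub (S1 phi1 phi2).
Proof.
have [mu1 [mu2 [mu1_neq0 mu2_neq0 SE]]] := S1_lower_system.
move=> da M /SE[ul dr sys].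
have [ur dl] := lower_system_eq0 char0 abm cdm mu1_neq0 mu2_neq0 sys da.
exact: sub_block0.
Qed.

Lemma S1_lower_iso : (a <= d)%N -> iso_Vk (@sl2_tensor K a b c d) (S1 phi1 phi2) (d - a).
Proof.
have [mu1 [mu2 [mu1_neq0 mu2_neq0 SE]]] := S1_lower_system.
move=> ad; have ebc : (b - c = d - a)%N by lia.
have cb : (c <= b)%N by lia.
set k := (d - a)%N in ebc *.
(* The ratio between the two blocks that the equations impose. *)
pose nu := - (mu2 / mu1).
pose B (j : nat) : 'M[K]_(a.+1 + b.+1, c.+1 + d.+1) :=
  block_mx 0 (cg_basis K a d j) (nu *: (cg_basis K c b j)^T) 0.
have sumB (x : 'I_k.+1 -> K) : \sum_j x j *: B j =
    block_mx 0 (\sum_j x j *: cg_basis K a d j) (nu *: (\sum_j x j *: cg_basis K c b j)^T) 0.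
  apply: (big_ind3 (fun X Y Z => X = block_mx 0 Y (nu *: Z^T) 0)) => [|X Y Z X' Y' Z' -> ->|j _].
  - by rewrite trmx0 scaler0 block_mx0.
  - by rewrite add_block_mx linearD scalerDr !addr0.
  - by rewrite scale_block_mx [(_ *: _)^T]linearZ /= !scaler0 !scalerA mulrC.
have S1_sum (x : 'I_k.+1 -> K) : S1 phi1 phi2 (\sum_j x j *: B j).
  have S1B (j : 'I_k.+1) : S1 phi1 phi2 (B j).
    rewrite SE block_mxKul block_mxKur block_mxKdl block_mxKdr; split=> //.
    by apply: cg_basis_lower_system => //; rewrite leq_ord.
  rewrite S1E sumB block_mxKul block_mxKur block_mxKdl block_mxKdr; split=> // i.
  rewrite linear_sum scaler_sumr mulmx_sumr mulmx_suml -big_split big1 //= => j _.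
  have /S1E[_ _ /(_ i)] := S1B j; rewrite block_mxKur block_mxKdl => e.
  rewrite [(_ *: _)^T]linearZ /= scalerA [nu * _]mulrC -scalerA -scalemxAr -scalemxAl -scalerDr e.
  by rewrite scaler0.
exists (fun j : 'I_k.+1 => B j); split; [|split].
- move=> x; rewrite sumB -[RHS](@block_mx0 K a.+1 b.+1 c.+1 d.+1).
  move=> /eq_block_mx[_ x0 _ _] l.
  have := @ent_sum_cg_basis _ a d (fun j => x (inord j)) 0 (a + l) ad (leq0n a).
  rewrite -/k; under eq_bigr do rewrite inord_val.
  rewrite x0 ent0 add0n leq_addr bin0 expr0 !mulr1 addKn inord_val => -> //.
  by have := leq_ord l; lia.
- move=> M; split=> [/SE[ul dr sys]|[x ->]]; last exact: S1_sum.
  have [eP eQ] := lower_system_span char0 abm cdm mu1_neq0 mu2_neq0 sys ad.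
  exists (fun j => ent (ursubmx M) 0 (a + j)); rewrite sumB.
  by rewrite -[LHS]submxK ul dr {1}eP {1}eQ.
move=> g j; under eq_bigr do rewrite ent_ord.
have -> : \sum_(l < k.+1) ent (sl2mat K g k) l j *: B l =
    \sum_(l < k.+1) (fun l : 'I_k.+1 => ent (sl2mat K g k) l j) l *: B l by [].
rewrite sumB /sl2_tensor /tensor_act /Esl2 /B tr_block_mx !mulmx_block !trmx0.
rewrite !(mul0mx, mulmx0, addr0, add0r) add_block_mx !(addr0, add0r).
rewrite -(cg_basis_act K g ad (leq_ord j)) -/k; congr block_mx.
(* The lower left block lies in V(b) (x) V(c), with the factors in the opposite order to
   [cg_basis K c b]; transposition exchanges the two terms of the action. *)
have := cg_basis_act K g cb (_ : (j <= b - c)%N); rewrite ebc => <-; last by rewrite leq_ord.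
by rewrite linearD /= !trmx_mul trmxK scalerDr -scalemxAr -scalemxAl addrC.
Qed.

End LowerCase.

Unset Implicit Arguments.
Set Strict Implicit.

Theorem theorem4p3 (K : fieldType) (hK : [pchar K] =i pred0)
  (n m : nat) (hn : (1 <= n)%N) (hm : m = (2 * n - 1)%N)
  (a b : nat) (hab : (a + b)%N = m) (ha : a <> 0%N) (hb : b <> 0%N)
  (phi1 : 'I_m.+1 -> 'M[K]_(a.+1, b.+1)) (hphi1 : @cg_map K m a b phi1) :
  (* (i) V_2 = E(c,d), c + d = m, 0 < a <= c < m *)
  (forall (c d : nat) (phi2 : 'I_m.+1 -> 'M[K]_(c.+1, d.+1)),
     @cg_map K m c d phi2 -> (c + d)%N = m -> (0 < a)%N -> (a <= c)%N -> (c < m)%N ->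
     (((d%:Z - a%:Z = b%:Z - c%:Z) /\ (0 <= d%:Z - a%:Z)) ->
        iso_Vk (@sl2_tensor K a b c d) (S1 phi1 phi2) (d - a)) /\
     (~ ((d%:Z - a%:Z = b%:Z - c%:Z) /\ (0 <= d%:Z - a%:Z)) ->
        is_zero_sub (S1 phi1 phi2))) /\
  (* (ii) V_2 = Z(c,1) = E(c, c+m) *)
  (forall (c : nat) (phi2 : 'I_m.+1 -> 'M[K]_(c.+1, (c + m).+1)),
     @cg_map K m c (c + m) phi2 ->
     (c = 0%N -> iso_Vk (@sl2_tensor K a b c (c + m)) (S1 phi1 phi2) b) /\
     (c <> 0%N -> is_zero_sub (S1 phi1 phi2))) /\
  (* (iii) V_2 = Z(d,1)^* = E(d+m, d) *)
  (forall (d : nat) (phi2 : 'I_m.+1 -> 'M[K]_((d + m).+1, d.+1)),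
     @cg_map K m (d + m) d phi2 -> is_zero_sub (S1 phi1 phi2)).
Proof.
split; [|split].
(* Since [a + b = c + d], the alternative is between [a <= d] and [d < a]. *)
- move=> c d phi2 phi2P cdm _ _ _; split=> [[_ ad]|nad].
    by apply: (S1_lower_iso hK hab cdm hphi1 phi2P); lia.
  by apply: (S1_lower_eq0 hK hab cdm hphi1 phi2P); lia.
- move=> c phi2 phi2P; split=> [c0|c0].
    subst c; have bE : b = (0 + m - a)%N by lia.
    rewrite [X in iso_Vk _ _ X]bE.
    by apply: (S1_lower_iso hK hab _ hphi1 phi2P); lia.
  by apply: (S1_upper_eq0 hK hphi1 hab phi2P); lia.
by move=> d phi2 phi2P; apply: (S1_cartan_eq0 hK hphi1 hab phi2P); lia.
Qed.
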